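(* Let $(a_1,\dots,a_n)\in\Sigma$, $S=\{\pm a_1,\dots,\pm a_n\}$, and let $m\ge1$ be an integer. If $S\cap(m+1)\mathbb{Z}=\varnothing$, then $\chi(a_1,\dots,a_n)\le m+2$.
   Context: $\Sigma$ is the set of strictly increasing sequences $a_1<\dots<a_n$ of positive integers with $\gcd(a_1,\dots,a_n)=1$. The Schreier graph $G_S$ has vertex set $F(2^\mathbb{Z})=\{x\in2^\mathbb{Z}: s\cdot x\ne x\ \forall s\ne0\}$ with $(s\cdot x)(m)=x(m+s)$, and $x,y$ adjacent iff $s\cdot x=y$ for some $s\in S$. $\chi(a_1,\dots,a_n)$ is the Borel chromatic number of $G_S$ (least size of a finite discrete set $K$ admitting a Borel proper coloring $F(2^\mathbb{Z})\to K$). *)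

(* Defs.v *)
From mathcomp Require Export all_boot all_order all_algebra.
From mathcomp Require Export all_classical reals ereal topology measure.

Set Implicit Arguments.
Unset Strict Implicit.
Unset Printing Implicit Defensive.

Import Order.TTheory GRing.Theory Num.Theory.

Local Open Scope classical_set_scope.
Local Open Scope ring_scope.

Definition in_Sigma (a : seq nat) : bool :=
  [&& sorted ltn a, all (ltn 0) a & \big[gcdn/0%N]_(b <- a) b == 1%N].

Definition sym_set (a : seq nat) : set int :=
  [set s | exists2 b : nat, b \in a & s = b%:Z \/ s = - b%:Z].

Definition borel (X : topologicalType) : set (set X) := <<s @open X >>.
Arguments borel : clear implicits.

Definition borel_proper_coloring (X : topologicalType) (G : X -> X -> Prop)
    (K : finType) (c : X -> K) : Prop :=
  (forall B : set K, borel X (c @^-1` B)) /\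
  (forall x y : X, G x y -> c x <> c y).

Definition borel_colorable (X : topologicalType) (G : X -> X -> Prop)
    (k : nat) : Prop :=
  exists2 K : finType, #|K| = k & exists c : X -> K, borel_proper_coloring G c.

(* The value is [+oo] when no finite Borel proper coloring exists. *)
Definition borel_chromatic_number (X : topologicalType) (G : X -> X -> Prop) :
    \bar int :=
  if pselect (exists k, `[< borel_colorable G k >]) is left colorable
  then (ex_minn colorable)%:Z%:E else +oo%E.

(* 2^Z with the product topology. *)
Notation binary_seqs := {ptws int -> bool}.

Definition shift (s : int) (x : binary_seqs) : binary_seqs :=
  fun m => x (m + s).

Definition free_part : set binary_seqs :=
  [set x | forall s : int, s != 0 -> shift s x <> x].

(* [set_type free_part] carries the subspace topology. *)
Definition schreier_graph (S : set int) (x y : set_type free_part) : Prop :=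
  exists2 s : int, S s & shift s (set_val x) = set_val y.

Definition chi (a : seq nat) : \bar int :=
  borel_chromatic_number (schreier_graph (sym_set a)).

(* Main.v *)
(* The coloring [i mod (m+1)] of Z is proper since no element of S is divisible
   by m+1.  The spare color lets one recolor whole residue classes one at a time;
   if successive recolorings are at least [max S] apart, the coloring stays
   proper.  After [d (m+2)] well-chosen recolorings the coloring is
   [i + d mod (m+1)], so any phase shift can be realized on a long enough
   interval.  A Borel marker set with large bounded gaps on each orbit cuts it
   into such intervals; on each one the phase is restarted at the left end and
   adjusted to fit the next interval. *)
Require Import Defs.
From mathcomp Require Import zify.

Set Implicit Arguments.
Unset Strict Implicit.
Unset Printing Implicit Defensive.

Import Order.TTheory GRing.Theory Num.Theory.

(** * Recoloring residue classes on a single interval *)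

(* Color of the residue class [r] after [j] recolorings, the classes being
   treated in the cyclic order m, m-1, ..., 0, m, ...; each recoloring adds 1
   mod m+2, which is the color that is free at that moment. *)
Definition stage_color (m j r : nat) : nat := (r + (j + r) %/ m.+1) %% m.+2.

Lemma eqn_mod_lt (d x y : nat) : (x <= y < x + d)%N -> x = y %[mod d] -> x = y.
Proof.
move=> /andP[xy yd] /eqP; rewrite eq_sym eqn_mod_dvd // => /dvdnP[k].
case: k => [|k]; nia.
Qed.

(** Before reduction the colors differ by at least 1 and at most [m+1]: the residues contribute
    between 1 and [m], the quotients 0 or 1 with the same sign. The offset [e] allows for one
    recoloring between the two points. *)
Lemma stage_color_neq (m j e r r' : nat) : (e <= 1)%N -> (r <= m)%N -> (r' <= m)%N ->
  r <> r' -> stage_color m j r <> stage_color m (j + e) r'.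
Proof.
move=> e1 rm r'm rr'; rewrite /stage_color => E.
have [A|A] : (r + (j + r) %/ m.+1 <= r' + (j + e + r') %/ m.+1)%N \/
   (r' + (j + e + r') %/ m.+1 <= r + (j + r) %/ m.+1)%N by lia.
- have := @eqn_mod_lt m.+2 _ _ _ E.
  have := divn_eq (j+r) m.+1; have := ltn_pmod (j+r) (ltn0Sn m).
  have := divn_eq (j+e+r') m.+1; have := ltn_pmod (j+e+r') (ltn0Sn m).
  nia.
- have := @eqn_mod_lt m.+2 _ _ _ (esym E).
  have := divn_eq (j+r) m.+1; have := ltn_pmod (j+r) (ltn0Sn m).
  have := divn_eq (j+e+r') m.+1; have := ltn_pmod (j+e+r') (ltn0Sn m).
  nia.
Qed.

(** These are [d] full rounds followed by [d] more recolorings. The extra ones hit exactly the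
    classes with [r + d > m], which thereby skip the spare color [m+1], so that adding modulo [m+2]
    becomes adding modulo [m+1]. *)
Lemma stage_color_phase (m d r : nat) : (d <= m)%N -> (r <= m)%N ->
  stage_color m (d * m.+2) r = ((r + d) %% m.+1)%N.
Proof.
move=> dm rm; rewrite /stage_color mulnSr -addnA divnMDl // addnA (addnC d r).
have [A|A] := ltnP (r + d) m.+1.
  by rewrite divn_small // addn0 !modn_small //; lia.
have -> : (r + d = m.+1 + (r + d - m.+1))%N by lia.
rewrite modnDl divnDl ?dvdnn// divnn /= divn_small; last by lia.
rewrite [RHS]modn_small; last by lia.
rewrite addn0 (_ : m.+1 + _ + _ = m.+2 + (r + d - m.+1))%N; last by lia.
by rewrite modnDl modn_small //; lia.
Qed.

(** The representative of [-g] modulo [m+1]; the outer reduction sends multiples of [m+1] to 0. *)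
Definition gap_shift (m g : nat) : nat := (m.+1 - g %% m.+1) %% m.+1.

(* Color at distance [p] from the left end of an interval of length [g]; one
   recoloring takes place every [D] steps until the phase agrees with [p - g]. *)
Definition gap_color (m D g p : nat) : nat :=
  stage_color m (minn (p %/ D) (gap_shift m g * m.+2)) (p %% m.+1).

Lemma gap_color_lt (m D g p : nat) : (gap_color m D g p < m.+2)%N.
Proof. exact: ltn_pmod. Qed.

(** A step of length at most [D] meets at most one recoloring, so [stage_color_neq] applies. *)
Lemma gap_color_neq (m D g p b : nat) : (b <= D)%N -> ~~ (m.+1 %| b) ->
  gap_color m D g p <> gap_color m D g (p + b).
Proof.
move=> bD ndvd.
have [D0|D0] := posnP D; first by move: ndvd; rewrite (_ : b = 0%N) ?dvdn0; lia.
have le1 : (p %/ D <= (p + b) %/ D)%N by apply: leq_div2r; rewrite leq_addr.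
have le2 : ((p + b) %/ D <= p %/ D + 1)%N.
  by rewrite addn1 -ltnS ltn_divLR// (divn_eq p D); have := ltn_pmod p D0; nia.
rewrite /gap_color; move: (gap_shift m g * m.+2)%N => K.
rewrite (_ : minn ((p + b) %/ D) K =
  minn (p %/ D) K + (minn ((p + b) %/ D) K - minn (p %/ D) K))%N; last by lia.
apply: stage_color_neq; [lia|by rewrite -ltnS ltn_pmod..|].
move/eqP; rewrite eq_sym eqn_mod_dvd ?leq_addr// addKn.
exact/negP.
Qed.

(** At most [m(m+2) < (m+1)^2] recolorings are needed, so all are done by position [g], and the
    phase [-g] gives [g + e] the color [e] modulo [m+1]. A new interval starts with the same colors,
    its first recoloring coming only at [D]. *)
Lemma gap_color_cross (m D g g' e : nat) : (e < D)%N -> (D * m.+1 ^ 2 <= g)%N ->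
  gap_color m D g (g + e) = gap_color m D g' e.
Proof.
move=> eD Dg; have D0 : (0 < D)%N by lia.
have gs : (gap_shift m g <= m)%N by rewrite -ltnS ltn_pmod.
rewrite /gap_color (divn_small eD) min0n (minn_idPr _); last first.
  by rewrite leq_divRL//; apply: leq_trans (leq_trans Dg (leq_addr _ _)); nia.
have := @stage_color_phase m 0 (e %% m.+1) (leq0n m); rewrite mul0n => ->; last first.
  by rewrite -ltnS ltn_pmod.
rewrite stage_color_phase//; last by rewrite -ltnS ltn_pmod.
rewrite addn0 /gap_shift modnDmr modnDml modn_mod.
rewrite (_ : g + e + _ = (g %/ m.+1).+1 * m.+1 + e)%N ?modnMDl//.
have := divn_eq g m.+1; have := ltn_pmod g (ltn0Sn m); rewrite mulSn.
move: (_ * _)%N (_ %% _)%N => u v; lia.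
Qed.

(** * Closure properties of Borel predicates on the free part *)

Local Open Scope classical_set_scope.
Local Open Scope ring_scope.

(* Quantifying over all shifts makes this property shift-invariant without
   having to make the shift a map of the subtype [free_part]. *)
Definition borel_pred (P : binary_seqs -> Prop) : Prop :=
  forall s : int, borel (set_type free_part) [set x | P (shift s (set_val x))].

Lemma shiftD (s t : int) (x : binary_seqs) : shift s (shift t x) = shift (s + t) x.
Proof. by apply/funext => k; rewrite /shift addrA. Qed.

Lemma shift0 (x : binary_seqs) : shift 0 x = x.
Proof. by apply/funext => k; rewrite /shift addr0. Qed.

Lemma free_part_shift (s : int) (x : binary_seqs) : free_part x -> free_part (shift s x).
Proof.
move=> Fx t t0 E; apply: (Fx t t0).
have := congr1 (shift (- s)) E.
by rewrite !shiftD addrAC addNr add0r shift0.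
Qed.

Lemma borel_pred_shift (P : binary_seqs -> Prop) (t : int) :
  borel_pred P -> borel_pred (fun x => P (shift t x)).
Proof.
move=> BP s; have := BP (t + s); congr borel.
by apply/funext => x /=; rewrite shiftD.
Qed.

Lemma borel_pred_not (P : binary_seqs -> Prop) :
  borel_pred P -> borel_pred (fun x => ~ P x).
Proof.
move=> BP s; have := sigma_algebraCD (BP s); congr borel.
by rewrite setTD.
Qed.

Lemma borel_pred_exists (T : countType) (P : T -> binary_seqs -> Prop) :
  (forall t, borel_pred (P t)) -> borel_pred (fun x => exists t, P t x).
Proof.
move=> BP s.
pose F (n : nat) : set (set_type free_part) :=
  if unpickle n is Some t then [set x | P t (shift s (set_val x))] else set0.
have BF n : borel _ (F n).
  by rewrite /F; case: unpickle => [t|]; [exact: BP|exact: sigma_algebra0].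
have := sigma_algebra_bigcup BF; congr borel; apply/seteqP; split => x /=.
  by move=> [n _]; rewrite /F; case: unpickle => // t ?; exists t.
by move=> [t Pt]; exists (pickle t) => //; rewrite /F pickleK.
Qed.

Lemma borel_pred_iff (P Q : binary_seqs -> Prop) :
  (forall x, P x <-> Q x) -> borel_pred P -> borel_pred Q.
Proof. by move=> PQ; rewrite (_ : P = Q)//; apply/funext => x; apply/propext. Qed.

Lemma borel_pred_forall (T : countType) (P : T -> binary_seqs -> Prop) :
  (forall t, borel_pred (P t)) -> borel_pred (fun x => forall t, P t x).
Proof.
move=> BP; apply: (@borel_pred_iff (fun x => ~ exists t, ~ P t x)).
  by move=> x; split=> [H t|H [t]]; [apply: contrapT => nP; apply: H; exists t|exact].
by apply: borel_pred_not; apply: borel_pred_exists => t; exact: borel_pred_not.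
Qed.

Lemma borel_pred_and (P Q : binary_seqs -> Prop) :
  borel_pred P -> borel_pred Q -> borel_pred (fun x => P x /\ Q x).
Proof.
move=> BP BQ; apply: (@borel_pred_iff (fun x => forall b : bool, if b then P x else Q x)).
  by move=> x; split=> [H|[? ?] []//]; split; [exact: (H true)|exact: (H false)].
by apply: borel_pred_forall => -[].
Qed.

Lemma borel_pred_or (P Q : binary_seqs -> Prop) :
  borel_pred P -> borel_pred Q -> borel_pred (fun x => P x \/ Q x).
Proof.
move=> BP BQ; apply: (@borel_pred_iff (fun x => exists b : bool, if b then P x else Q x)).
  by move=> x; split=> [[[] ?]|[?|?]]; [left|right|exists true|exists false].
by apply: borel_pred_exists => -[].
Qed.

Lemma borel_pred_cst (P : Prop) : borel_pred (fun=> P).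
Proof.
have [p|np] := pselect P.
- apply: (@borel_pred_iff (fun=> forall t : void, True)); first by [].
  by apply: borel_pred_forall => -[].
- apply: (@borel_pred_iff (fun=> exists t : void, True)); first by move=> x; split => // -[[]].
  by apply: borel_pred_exists => -[].
Qed.

Lemma borel_pred_coord (k : int) (b : bool) : borel_pred (fun x => x k = b).
Proof.
move=> s; apply: sub_sigma_algebra.
have -> : [set x : set_type free_part | shift s (set_val x) k = b] =
  (@proj int (fun=> bool) (k + s) \o (set_val : set_type free_part -> binary_seqs)) @^-1` [set b] by [].
apply: open_comp; last exact: discrete_open.
move=> x _; apply: continuous_comp; first exact: initial_continuous.
exact: proj_continuous.
Qed.

(** * Borel marker sets with bounded gaps *)

(* The condition on [w] forces the cylinder to be disjoint from its translates
   by [s], 0 < |s| <= L. *)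
Definition aperiodic_cylinder (L : nat) (w : seq (int * bool)) (x : binary_seqs) : Prop :=
  (forall s : int, 0 < `|s| <= L%:Z ->
     exists k v, (k, v) \in w /\ (k + s, ~~ v) \in w) /\
  (forall kv, kv \in w -> x kv.1 = kv.2).

Lemma borel_pred_aperiodic_cylinder (L : nat) (w : seq (int * bool)) :
  borel_pred (aperiodic_cylinder L w).
Proof.
apply: borel_pred_and; first exact: borel_pred_cst.
apply: borel_pred_forall => kv; have [kvw|kvw] := boolP (kv \in w).
  by apply: (borel_pred_iff _ (borel_pred_coord kv.1 kv.2)) => x; split=> // ->.
by apply: (borel_pred_iff _ (borel_pred_cst True)) => x; split.
Qed.

Lemma aperiodic_cylinder_sep (L : nat) (w : seq (int * bool)) (x : binary_seqs) (s : int) :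
  0 < `|s| <= L%:Z -> aperiodic_cylinder L w x -> ~ aperiodic_cylinder L w (shift s x).
Proof.
move=> sL [/(_ s sL)[k [v [kw ksw]]] xw] [_ /(_ _ kw)].
by rewrite /shift (xw _ ksw) /=; case: v {kw ksw}.
Qed.

(** Freeness gives for each nonzero [s] a coordinate where [x] and its translate by [s] disagree;
    [w] records such witnesses for the finitely many [s] with [|s| <= L]. *)
Lemma aperiodic_cylinder_cover (L : nat) (x : binary_seqs) :
  free_part x -> exists w, aperiodic_cylinder L w x.
Proof.
move=> Fx.
have /choice[K HK] : forall s : int, exists k : int, s != 0 -> x (k + s) <> x k.
  move=> s; have [->|s0] := eqVneq s 0; first by exists 0.
  apply: contrapT => /forallNP H; apply: (Fx s s0); apply/funext => k.
  by apply: contrapT => E; apply: (H k) => _; exact: E.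
exists (flatten [seq [:: (K s, x (K s)); (K s + s, x (K s + s))] |
  s <- [seq i%:Z - L%:Z | i <- iota 0 L.*2.+1]]); split.
- move=> s /andP[s0 sL]; exists (K s), (x (K s)).
  have sin : s \in [seq i%:Z - L%:Z | i <- iota 0 L.*2.+1].
    by apply/mapP; exists (absz (s + L%:Z)); [rewrite mem_iota; lia|lia].
  have -> : ~~ x (K s) = x (K s + s).
    have := HK s; rewrite -normr_gt0 => /(_ s0).
    by case: (x (K s)); case: (x _).
  by split; apply/flatten_mapP; exists s => //; rewrite !inE eqxx ?orbT.
- by move=> kv /flatten_mapP[s _]; rewrite !inE => /orP[]/eqP->.
Qed.

(* Greedy construction: the n-th cylinder contributes all its points at
   distance more than [L] from what has been selected before. *)
Fixpoint marker_stage (L n : nat) (x : binary_seqs) : Prop :=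
  if n is n'.+1 then
    marker_stage L n' x \/
    ((exists w, unpickle n' = Some w /\ aperiodic_cylinder L w x) /\
     forall s : int, `|s| <= L%:Z -> ~ marker_stage L n' (shift s x))
  else False.

Definition marker (L : nat) (x : binary_seqs) : Prop := exists n, marker_stage L n x.

Lemma borel_pred_marker (L : nat) : borel_pred (marker L).
Proof.
apply: borel_pred_exists; elim=> [|n IH] /=; first exact: borel_pred_cst.
apply: borel_pred_or => //; apply: borel_pred_and.
  apply: borel_pred_exists => w; apply: borel_pred_and; first exact: borel_pred_cst.
  exact: borel_pred_aperiodic_cylinder.
apply: borel_pred_forall => s; case: (boolP (`|s| <= L%:Z)) => sL.
  by apply: (borel_pred_iff _ (borel_pred_not (borel_pred_shift s IH))) => x; split=> // /(_ isT).
by apply: (borel_pred_iff _ (borel_pred_cst True)) => x; split.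
Qed.

Lemma marker_stage_leq (L n n' : nat) (x : binary_seqs) :
  (n <= n')%N -> marker_stage L n x -> marker_stage L n' x.
Proof.
move=> /subnK <-; elim: (n' - n)%N => // d IH /IH; rewrite addSn; exact: or_introl.
Qed.

(** Two points added at the same stage lie in the same aperiodic cylinder; a new point is far from
    the old ones by construction. *)
Lemma marker_stage_sep (L n : nat) (x : binary_seqs) (s : int) :
  0 < `|s| <= L%:Z -> marker_stage L n x -> ~ marker_stage L n (shift s x).
Proof.
move=> sL; elim: n x => [//|n IH] x /=.
have sL' : `|s| <= L%:Z by case/andP: sL.
move=> [xn|[[w [nw xw]] xn]] [yn|[[w' [nw' yw]] yn]].
- exact: (IH x).
- by apply: (yn (- s)); rewrite ?normrN// shiftD addNr shift0.
- exact: (xn s).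
- move: nw'; rewrite nw => -[ww']; rewrite -ww' in yw.
  exact: aperiodic_cylinder_sep sL xw yw.
Qed.

Lemma marker_sep (L : nat) (x : binary_seqs) (s : int) :
  0 < `|s| <= L%:Z -> marker L x -> ~ marker L (shift s x).
Proof.
move=> sL [n xn] [n' yn].
apply: (@marker_stage_sep L (maxn n n') x s sL).
  exact: marker_stage_leq (leq_maxl _ _) xn.
exact: marker_stage_leq (leq_maxr _ _) yn.
Qed.

(** When a cylinder containing [x] is treated, either a point within [L] of [x] was selected before
    or [x] itself is selected. *)
Lemma marker_syndetic (L : nat) (x : binary_seqs) :
  free_part x -> exists2 s : int, `|s| <= L%:Z & marker L (shift s x).
Proof.
move=> /(@aperiodic_cylinder_cover L)[w xw].
have [[s sL sx]|H] := pselect (exists2 s : int, `|s| <= L%:Z &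
    marker_stage L (pickle w) (shift s x)).
  by exists s => //; exists (pickle w).
exists 0; first by rewrite normr0.
exists (pickle w).+1; right; rewrite shift0; split.
  by exists w; rewrite pickleK.
by move=> s sL sx; apply: H; exists s.
Qed.

(** * Gaps between consecutive markers *)

(* [pq = (p, q)]: the last marker position [<= 0] is [-p], the first one [> 0]
   is [q + 1]. *)
Definition marker_gap (L : nat) (x : binary_seqs) (pq : nat * nat) : Prop :=
  [/\ marker L (shift (- pq.1%:Z) x), marker L (shift pq.2.+1%:Z x) &
      forall i : int, - pq.1%:Z < i < pq.2.+1%:Z -> ~ marker L (shift i x)].

Lemma borel_pred_marker_gap (L : nat) (pq : nat * nat) :
  borel_pred (fun x => marker_gap L x pq).
Proof.
have BM i := borel_pred_shift i (borel_pred_marker L).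
apply: (@borel_pred_iff (fun x => marker L (shift (- pq.1%:Z) x) /\
  (marker L (shift pq.2.+1%:Z x) /\
   forall i : int, - pq.1%:Z < i < pq.2.+1%:Z -> ~ marker L (shift i x)))).
  by move=> x; split=> [[? [? ?]]|[]].
do 2!apply: borel_pred_and => //.
apply: borel_pred_forall => i; case: (boolP (- pq.1%:Z < i < pq.2.+1%:Z)) => ipq.
  by apply: (borel_pred_iff _ (borel_pred_not (BM i))) => x; split=> // /(_ isT).
by apply: (borel_pred_iff _ (borel_pred_cst True)) => x; split.
Qed.

(** No end of either gap lies strictly inside the other, and both gaps surround the origin. *)
Lemma marker_gap_unique (L : nat) (x : binary_seqs) (pq pq' : nat * nat) :
  marker_gap L x pq -> marker_gap L x pq' -> pq = pq'.
Proof.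
move: pq pq' => [p q] [p' q'] [/= Mp Mq N] [/= Mp' Mq' N'].
have ? : ~ (- p%:Z < - p'%:Z < q.+1%:Z) by move=> /N.
have ? : ~ (- p%:Z < q'.+1%:Z < q.+1%:Z) by move=> /N.
have ? : ~ (- p'%:Z < - p%:Z < q'.+1%:Z) by move=> /N'.
have ? : ~ (- p'%:Z < q.+1%:Z < q'.+1%:Z) by move=> /N'.
by congr pair; lia.
Qed.

Lemma marker_gap_ge (L : nat) (x : binary_seqs) (p q : nat) :
  marker_gap L x (p, q) -> (L <= p + q)%N.
Proof.
move=> [/= Mp Mq _]; rewrite leqNgt; apply/negP => lt.
apply: (@marker_sep L _ (p + q.+1)%:Z _ Mp); first lia.
by rewrite shiftD (_ : _ - _ = q.+1%:Z)//; lia.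
Qed.

Lemma marker_gap_exists (L : nat) (x : binary_seqs) :
  free_part x -> exists pq, marker_gap L x pq.
Proof.
move=> Fx.
have exP : exists p : nat, `[< marker L (shift (- p%:Z) x) >].
  (* Recentring at [-L] puts a marker within distance [L] at a position [<= 0]; recentring at [L+1]
     below makes the position positive. *)
  have [s sL Ms] := @marker_syndetic L _ (@free_part_shift (- L%:Z) _ Fx).
  exists (absz (L%:Z - s)); apply/asboolP; move: Ms; rewrite shiftD; congr (marker L (shift _ x)); lia.
have exQ : exists q : nat, `[< marker L (shift q.+1%:Z x) >].
  have [s sL Ms] := @marker_syndetic L _ (@free_part_shift L.+1%:Z _ Fx).
  exists (absz (L%:Z + s)); apply/asboolP; move: Ms; rewrite shiftD; congr (marker L (shift _ x)); lia.
case: (ex_minnP exP) => p /asboolP Mp minp.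
case: (ex_minnP exQ) => q /asboolP Mq minq.
exists (p, q); split=> //= i /andP[ip iq] Mi.
have [i0|i0] := ltrP 0 i.
  have : (q <= (absz i).-1)%N; last lia.
  by apply: minq; apply/asboolP; move: Mi; congr (marker L (shift _ x)); lia.
have : (p <= absz i)%N; last lia.
by apply: minp; apply/asboolP; move: Mi; congr (marker L (shift _ x)); lia.
Qed.

(** Markers are more than [L] apart, so a step [b <= L] crosses at most one. In the second case the
    new gap starts at [q + 1], and the equation has the form [g + p'] that [gap_color_cross]
    expects. *)
Lemma marker_gap_shift (L : nat) (x : binary_seqs) (p q p' q' b : nat) :
  (b <= L)%N -> marker_gap L x (p, q) -> marker_gap L (shift b%:Z x) (p', q') ->
  (p' = p + b /\ p' + q' = p + q)%N \/ (p + b = p + q.+1 + p')%N.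
Proof.
move=> bL G G'; have [/= Mp Mq N] := G.
have [bq|qb] := ltnP b q.+1.
  left; suff [-> ->] : (p', q') = ((p + b)%N, (q - b)%N) by lia.
  apply: marker_gap_unique G' _; split=> /=.
  - by rewrite shiftD (_ : _ + _ = - p%:Z)//; lia.
  - by rewrite shiftD (_ : _ + _ = q.+1%:Z)//; lia.
  - by move=> i ipq; rewrite shiftD; apply: N; lia.
right; have [/= Mp' Mq' N'] := G'.
have Nq : ~ (- p'%:Z < q.+1%:Z - b%:Z < q'.+1%:Z).
  by move=> /N'; rewrite shiftD subrK.
have far i : 0 < `|i| <= L%:Z -> ~ marker L (shift (i + q.+1%:Z) x).
  by move=> iL; rewrite -shiftD; exact: marker_sep.
(* A later left end would be a second marker in the window from [q + 1] to [b], too close to the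
   first. *)
have Mp'' : ~ (q.+1%:Z < b%:Z - p'%:Z).
  move=> lt; apply: (far (b%:Z - p'%:Z - q.+1%:Z)); first lia.
  by move: Mp'; rewrite shiftD; congr (marker L (shift _ x)); lia.
lia.
Qed.

(** * The Borel proper coloring *)

Definition marker_coloring (m D : nat) (x : set_type free_part) : 'I_m.+2 :=
  let pq := xget (0%N, 0%N) (marker_gap (D * m.+1 ^ 2) (set_val x)) in
  Ordinal (gap_color_lt m D (pq.1 + pq.2.+1) pq.1).

Lemma marker_coloringE (m D : nat) (x : set_type free_part) (p q : nat) :
  marker_gap (D * m.+1 ^ 2) (set_val x) (p, q) ->
  marker_coloring m D x = gap_color m D (p + q.+1) p :> nat.
Proof.
move=> G; rewrite /marker_coloring; case: xgetP => [[p' q'] _ G'|/(_ _ G)//] /=.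
by case: (marker_gap_unique G G') => -> ->.
Qed.

(** The color depends only on the gap, so the preimage is a countable union over the pairs
    [(p, q)]. *)
Lemma borel_marker_coloring (m D : nat) (B : set 'I_m.+2) :
  borel (set_type free_part) (marker_coloring m D @^-1` B).
Proof.
set L := (D * m.+1 ^ 2)%N.
have : borel_pred (fun x => exists pq, marker_gap L x pq /\
    B (Ordinal (gap_color_lt m D (pq.1 + pq.2.+1) pq.1))).
  apply: borel_pred_exists => pq; apply: borel_pred_and; last exact: borel_pred_cst.
  exact: borel_pred_marker_gap.
move=> /(_ 0); congr borel; apply/seteqP; split => x /=; rewrite shift0.
  move=> [[p q] [G Bpq]]; move: Bpq; congr B; apply: ord_inj.
  by rewrite (marker_coloringE G).
move=> Bx; have [[p q] G] := @marker_gap_exists L (set_val x) (set_valP x).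
exists (p, q); split=> //; move: Bx; congr B; apply: ord_inj.
by rewrite (marker_coloringE G).
Qed.

Lemma marker_coloring_neq (m D b : nat) (x y : set_type free_part) :
  (b < D)%N -> ~~ (m.+1 %| b)%N -> shift b%:Z (set_val x) = set_val y ->
  marker_coloring m D x <> marker_coloring m D y.
Proof.
move=> bD ndvd xy /(congr1 (@nat_of_ord _)).
set L := (D * m.+1 ^ 2)%N.
have DL : (D <= L)%N by rewrite leq_pmulr// expn_gt0.
have [[p q] G] := @marker_gap_exists L (set_val x) (set_valP x).
have [[p' q'] G'] := @marker_gap_exists L (set_val y) (set_valP y).
rewrite (marker_coloringE G) (marker_coloringE G').
rewrite -xy in G'.
have bL : (b <= L)%N by lia.
have [[-> pq]|pb] := marker_gap_shift bL G G'.
  rewrite (_ : (p + b + q'.+1) = p + q.+1)%N; last lia.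
  exact: gap_color_neq (ltnW bD) ndvd.
(* The color of [y] is read as that of position [p + b] in the gap of [x], prolonged beyond its end.
   Here [p' < D] because [p' < b]. *)
rewrite -(@gap_color_cross m D (p + q.+1) (p' + q'.+1) p'); last 2 first.
- lia.
- by have := marker_gap_ge G; rewrite -/L; lia.
by rewrite -pb; exact: gap_color_neq (ltnW bD) ndvd.
Qed.

Theorem theorem5p6 (a : seq nat) (m : nat) (Ha : in_Sigma a) (Hm : (1 <= m)%N)
    (HS : sym_set a `&` [set m.+1%:Z * k | k in [set: int]] = set0) :
  (chi a <= m.+2%:Z%:E)%E.
Proof.
(* The successor makes every generator strictly smaller than [D]. *)
pose D := (\max_(b <- a) b).+1.
have aD b : b \in a -> (b < D)%N by move=> ba; rewrite ltnS leq_bigmax_seq.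
have a_ndvd b : b \in a -> ~~ (m.+1 %| b)%N.
  move=> ba; apply/negP => /dvdnP[k bk].
  suff : (sym_set a `&` [set m.+1%:Z * k | k in [set: int]]) b%:Z by rewrite HS.
  split; first by exists b => //; left.
  by exists k%:Z => //; rewrite bk mulrC PoszM.
have colorable : borel_colorable (schreier_graph (sym_set a)) m.+2.
  exists 'I_m.+2; first exact: card_ord.
  exists (marker_coloring m D); split; first exact: borel_marker_coloring.
  move=> x y [s [b ba [->|->]] xy]; first exact: marker_coloring_neq (aD b ba) (a_ndvd b ba) xy.
  (* For [s = -b] the edge is traversed backwards, from [y] to [x]. *)
  apply/nesym; apply: marker_coloring_neq (aD b ba) (a_ndvd b ba) _.
  by rewrite -xy shiftD addrN shift0.
rewrite /chi /borel_chromatic_number; case: pselect => [ex|[]]; last by exists m.+2; apply/asboolP.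
case: ex_minnP => k _ /(_ m.+2); rewrite lee_fin lez_nat; apply.
exact/asboolP.
Qed.
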